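(* For every integer $\ell \geq 3$ there exists an integer $k$ such that every $W_\ell$-induced-minor-free graph $G$ has a balanced separator dominated by at most $k$ vertices; that is, there exist a set $S \subseteq V(G)$ such that no component of $G - S$ contains more than $\frac{1}{2}|V(G)|$ vertices, and a set $D \subseteq V(G)$ with $|D| \leq k$ such that $S \subseteq N[D]$.
   Context: All graphs are finite and simple. For $\ell \geq 3$, $W_\ell$ (the $\ell$-wheel) is the graph obtained from a cycle of length $\ell$ by adding a vertex adjacent to all vertices of the cycle. A graph $H$ is an induced minor of $G$ if $H$ is isomorphic to a graph obtained from $G$ by deleting vertices and contracting edges (removing parallel edges); $G$ is $H$-induced-minor-free if $H$ is not an induced minor of $G$. For $A \subseteq V(G)$, $N[A]$ denotes the closed neighbourhood, i.e. $A$ together with all vertices adjacent to a vertex of $A$. The separator $S$ is not required to leave at least two components. *)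

(* Defs.v *)
From HB Require Import structures.
From mathcomp Require Import all_boot.

Set Implicit Arguments.
Unset Strict Implicit.
Unset Printing Implicit Defensive.

Record sgraph := SGraph {
  svertex :> finType;
  sedge : rel svertex;
  sedge_sym : symmetric sedge;
  sedge_irrefl : irreflexive sedge }.

Notation "x -- y" := (sedge x y) (at level 30).

Definition graph_iso (G H : sgraph) : Prop :=
  exists2 f : G -> H, bijective f & forall x y, (f x -- f y) = (x -- y).

Section Operations.
Variable G : sgraph.
Implicit Types u v : G.

Definition del_edge v : rel {x : G | x != v} := [rel x y | val x -- val y].

Fact del_edge_sym v : symmetric (@del_edge v).
Proof. by move=> x y; exact: sedge_sym. Qed.

Fact del_edge_irrefl v : irreflexive (@del_edge v).
Proof. by move=> x; exact: sedge_irrefl. Qed.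

Definition del_vertex v : sgraph :=
  SGraph (@del_edge_sym v) (@del_edge_irrefl v).

(* Contraction of the edge uv: v is removed and u stands for the merged
   vertex, so u becomes adjacent to every former neighbour of v other than u.
   Only meant for adjacent u and v (see [induced_minor]). *)
Definition contract_rel u v : rel {x : G | x != v} := [rel x y |
  (x != y) && [|| val x -- val y,
                  (val x == u) && (v -- val y)
                | (val y == u) && (v -- val x)]].

Fact contract_rel_sym u v : symmetric (@contract_rel u v).
Proof.
move=> x y; rewrite /contract_rel /= eq_sym (sedge_sym (val x)).
by congr (_ && (_ || _)); rewrite orbC.
Qed.

Fact contract_rel_irrefl u v : irreflexive (@contract_rel u v).
Proof. by move=> x; rewrite /contract_rel /= eqxx. Qed.

Definition contract u v : sgraph :=
  SGraph (@contract_rel_sym u v) (@contract_rel_irrefl u v).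

End Operations.

Inductive induced_minor (H : sgraph) : sgraph -> Prop :=
| induced_minor_iso G : graph_iso G H -> induced_minor H G
| induced_minor_del (G : sgraph) (v : G) :
    induced_minor H (del_vertex v) -> induced_minor H G
| induced_minor_contract (G : sgraph) (u v : G) :
    u -- v -> induced_minor H (contract u v) -> induced_minor H G.

Definition induced_minor_free (H G : sgraph) : Prop := ~ induced_minor H G.

(* [None] is the hub; the test [i != j] only matters for the degenerate l = 1. *)
Definition wheel_rel l : rel (option 'I_l) := fun x y =>
  match x, y with
  | Some i, Some j => (i != j) && ((j == ordS i) || (i == ordS j))
  | None, None => false
  | _, _ => true
  end.

Fact wheel_rel_sym l : symmetric (@wheel_rel l).
Proof. by move=> [i|] [j|] //=; rewrite eq_sym orbC. Qed.

Fact wheel_rel_irrefl l : irreflexive (@wheel_rel l).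
Proof. by move=> [i|] //=; rewrite eqxx. Qed.

Definition wheel l : sgraph := SGraph (@wheel_rel_sym l) (@wheel_rel_irrefl l).

Section Separators.
Variable G : sgraph.
Implicit Types A S : {set G}.

Definition closed_neigh A : {set G} :=
  A :|: [set y | [exists x in A, x -- y]].

Definition avoiding S : rel G :=
  [rel x y | [&& x \notin S, y \notin S & x -- y]].

(* The vertex sets of the connected components of G - S. *)
Definition components S : {set {set G}} :=
  equivalence_partition (connect (avoiding S)) (~: S).

Definition balanced_separator S : Prop :=
  forall C, C \in components S -> 2 * #|C| <= #|G|.

End Separators.

(* Main.v *)
Require Import Defs.
From HB Require Import structures.
From mathcomp Require Import all_boot.
From mathcomp Require Import zify.

Set Implicit Arguments.
Unset Strict Implicit.
Unset Printing Implicit Defensive.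

(* Suppose that no set N[D] with D small is a balanced separator, and write
   beta(D) for the component of G - N[D] with more than half of the vertices.
   An induced cycle C and a connected set disjoint from C have fewer than l
   contacts, since otherwise they contract to the wheel W_l.

   Step 1: some induced cycle is a balanced separator.  Follow a Gyarfas path
   q_1, q_2, ... into the big component until N[Q + p] is balanced while N[Q]
   is not, and let B be the big component of G - N[Q].  Among the vertices of
   N(B) - N[p] take the vertex t whose neighbour on Q closest to p is farthest
   from p, and close the path from p to that neighbour through t and B into an
   induced cycle C.  If G - C had a big component K, let F be its fewer than l
   contacts on C.  As N[Q + p] is balanced, beta(F + p) leaves B through some
   t' in N(B) - N[p]; by the choice of t, t' has a neighbour on C, which lies in
   F, so that t' is in N[F], a contradiction.

   Step 2: an induced cycle C cannot be a balanced separator.  All sets beta(D)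
   meet C.  If a component K of G - C has contacts f and g on C, then boundedly
   many vertices of C (the contacts of K, and the vertices between f and g from
   which one can cross over outside K) separate the open arc (f, g) from the
   rest of C, so beta of this set meets only one of the two sides.  In a
   smallest arc (x, y) still containing the trace on C of some beta(D), all such
   pairs f, g therefore point outwards.  Hence for each i in (x, y) boundedly
   many more vertices push the trace to the left or to the right of i: as long
   as both sides survive, they are joined by a longer chord.  Sweeping i from x
   to y gives a bounded set whose beta misses C. *)

(** * Connected sets *)

Section Connected.
Variable G : sgraph.
Implicit Types (A B H S Z : {set G}) (x y : G).

Definition inside A : rel G := [rel x y | [&& x \in A, y \in A & x -- y]].

(* The empty set counts as connected. *)
Definition conn A :=
  [forall x in A, forall y in A, connect (inside A) x y].

Definition adj A B := [exists x in A, exists y in B, x -- y].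

Lemma inside_sym A : symmetric (inside A).
Proof. by move=> x y; rewrite /inside /= sedge_sym andbCA. Qed.

Lemma connP A :
  reflect {in A &, forall x y, connect (inside A) x y} (conn A).
Proof.
apply: (iffP forall_inP) => [h x y xA yA|h x xA].
  by move/forall_inP: (h x xA) => /(_ y yA).
by apply/forall_inP => y yA; apply: h.
Qed.

Lemma adjP A B :
  reflect (exists x y, [/\ x \in A, y \in B & x -- y]) (adj A B).
Proof.
apply: (iffP exists_inP) => [[x xA /exists_inP[y yB xy]]|[x [y [xA yB xy]]]].
  by exists x, y.
by exists x => //; apply/exists_inP; exists y.
Qed.

Lemma adjC A B : adj A B = adj B A.
Proof.
by apply/adjP/adjP => -[x [y [? ? ?]]]; exists y, x; rewrite sedge_sym.
Qed.

Lemma connect_ind (e : rel G) (P : G -> Prop) x y :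
  connect e x y -> P x -> (forall u v, P u -> e u v -> P v) -> P y.
Proof.
case/connectP=> p + -> {y} + step; elim: p x => //= z p IH x /andP[xz zp] Px.
exact: IH zp (step _ _ Px xz).
Qed.

(** Otherwise [Z] would be closed under steps inside [A] and so contain [y]. This is the tool for
    following a connected set out of another set. *)
Lemma conn_edge A Z x y :
    conn A -> x \in A -> x \in Z -> y \in A -> y \notin Z ->
  exists u v, [/\ u \in A, u \in Z, v \in A, v \notin Z & u -- v].
Proof.
move=> /connP cA xA xZ yA yZ.
have [/existsP[u /existsP[v /and5P[*]]]|none] :=
  boolP [exists u, exists v,
    [&& u \in A, u \in Z, v \in A, v \notin Z & u -- v]].
  by exists u, v.
case/negP: yZ; apply: (@connect_ind _ (fun z =>
  z \in Z) _ _ (cA x y xA yA)) => // u v uZ.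
move=> /and3P[uA vA uv]; apply: contraNT none => vZ; apply/existsP; exists u;
  apply/existsP; exists v.
by rewrite uA uZ vA vZ uv.
Qed.

Lemma conn1 x : conn [set x].
Proof. by apply/connP => u v /set1P -> /set1P ->. Qed.

Lemma connect_insideS A B :
  A \subset B -> subrel (connect (inside A)) (connect (inside B)).
Proof.
move=> sAB; apply: connect_sub => u v /and3P[uA vA uv]; apply: connect1.
by rewrite /inside /= !(subsetP sAB) ?uA.
Qed.

Lemma connU A B z : conn A -> conn B -> z \in A -> z \in B -> conn (A :|: B).
Proof.
move=> /connP cA /connP cB zA zB.
have csym := sym_connect_sym (inside_sym (A :|: B)).
suff toz x : x \in A :|: B -> connect (inside (A :|: B)) x z.
  apply/connP => x y /toz xz /toz; rewrite csym; exact: connect_trans.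
case/setUP => xE; first by apply: (connect_insideS (subsetUl A B)); apply: cA.
by apply: (connect_insideS (subsetUr A B)); apply: cB.
Qed.

Lemma connU_adj A B : conn A -> conn B -> adj A B -> conn (A :|: B).
Proof.
move=> cA cB /adjP[x [y [xA yB xy]]].
have cxy : conn [set x; y].
  apply/connP => u v /set2P uE /set2P vE.
  case: uE vE => -> [] -> //; apply: connect1;
    by rewrite /inside /= !inE !eqxx ?orbT // sedge_sym.
have -> : A :|: B = A :|: [set x; y] :|: B.
  apply/setP => u; rewrite !inE.
  have [->|_] := eqVneq u x; first by rewrite xA.
  by have [->|_] := eqVneq u y; rewrite ?yB ?orbT ?orbF.
apply: (@connU _ _ y) => //; last by rewrite !inE eqxx !orbT.
by apply: (@connU _ _ x) => //; rewrite !inE eqxx.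
Qed.

(** Each vertex met on an [e]-walk from [x] is itself in the class, so the walk stays inside the
    class. *)
Lemma conn_class (e : rel G) x :
  subrel e (@sedge G) -> conn [set y | connect e x y].
Proof.
move=> esub; set A := [set y | _].
have fromx y : y \in A -> connect (inside A) x y.
  rewrite inE => xy.
  pose P z := connect e x z /\ connect (inside A) x z.
  apply: (proj2 (connect_ind (P := P) xy _ _)) => // u v [xu xuA] uv.
  have xv := connect_trans xu (connect1 uv); split=> //.
  apply: connect_trans xuA (connect1 _); rewrite /inside /= !inE xu xv.
  exact: esub.
apply/connP => u v uA vA; apply: connect_trans (fromx v vA).
by rewrite (sym_connect_sym (inside_sym A)) fromx.
Qed.

End Connected.

(** The alternative [f x = f y] allows for contractions, which identify the two ends of an edge. *)
Lemma conn_map (G G' : sgraph) (f : G -> G') (A : {set G}) :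
    {in A &, forall x y, x -- y -> f x = f y \/ f x -- f y} ->
  conn A -> conn (f @: A).
Proof.
move=> fE /connP cA; apply/connP => _ _ /imsetP[x xA ->] /imsetP[y yA ->].
pose P z := connect (inside (f @: A)) (f x) (f z).
apply: (connect_ind (P := P) (cA x y xA yA)) => // [|u v];
  first exact: connect0.
rewrite /P => xu /and3P[uA vA uv].
have [<- //|fuv] := fE u v uA vA uv; apply: connect_trans xu (connect1 _).
by rewrite /inside /= !imset_f.
Qed.

(** * Branch sets of induced minors *)

Section Models.

(** The branch sets of [H] in [G]. Since the minor is induced, non-adjacent vertices of [H] get
    non-adjacent branch sets. Vertices of [G] outside all branch sets are to be deleted. *)
Definition model (H G : sgraph) (M : H -> {set G}) :=
  [/\ forall h, M h != set0, forall h, conn (M h)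
    & forall h h', h != h' ->
        [disjoint M h & M h'] /\ adj (M h) (M h') = (h -- h')].

Lemma model_iso (H G : sgraph) (M : H -> {set G}) :
    model M -> (forall x, exists h, x \in M h) ->
  (forall h, {in M h &, forall x y, x = y}) -> graph_iso G H.
Proof.
move=> [M0 _ Md] cov one.
have memI x h h' : x \in M h -> x \in M h' -> h = h'.
  move=> xh xh'; apply/eqP; apply: contraT => /Md[/pred0P/(_ x)].
  by rewrite /= xh xh'.
pose f x := xchoose (cov x); have fP x : x \in M (f x) := xchooseP (cov x).
have ne h : exists x, x \in M h by apply/set0Pn.
exists f.
  exists (fun h => xchoose (ne h)) => [x|h].
    exact: one (xchooseP (ne (f x))) (fP x).
  exact: memI (fP _) (xchooseP (ne h)).
move=> x y; have [xy|nxy] := eqVneq (f x) (f y).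
  have yx : y \in M (f x) by rewrite xy.
  by rewrite (one _ _ _ (fP x) yx) !sedge_irrefl.
have [_ <-] := Md _ _ nxy; apply/adjP/idP => [[u [v [uM vM uv]]]|xy].
  by rewrite (one _ _ _ (fP x) uM) (one _ _ _ (fP y) vM).
by exists x, y; split.
Qed.

Lemma model_del (H G : sgraph) (M : H -> {set G}) (v : G) :
    model M -> (forall h, v \notin M h) ->
  model (fun h => [set x : del_vertex v | val x \in M h]).
Proof.
move=> [M0 Mc Md] vM.
have ne h x : x \in M h -> x != v by apply: contraTneq => ->.
split=> [h|h|h h' hh'].
- have /set0Pn[x xh] := M0 h; apply/set0Pn.
  by exists (Sub x (ne h x xh) : del_vertex v); rewrite inE SubK.
- have /set0Pn[x0 x0h] := M0 h.
  pose d : del_vertex v := Sub x0 (ne h x0 x0h).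
  have dK x : x \in M h -> val (insubd d x) = x.
    by move=> xh; rewrite val_insubd (ne h).
  have -> : [set x : del_vertex v | val x \in M h]
          = (fun x => insubd d x : del_vertex v) @: M h.
    apply/setP => x; rewrite inE; apply/idP/imsetP => [xh|[y yh ->]].
      by exists (val x); rewrite ?valKd.
    by rewrite dK.
  apply: conn_map (Mc h) => x y xh yh xy; right.
  by rewrite /sedge /= /del_edge /= !dK.
- have [dis <-] := Md h h' hh'; split.
    by apply/pred0P => x; rewrite /= !inE; have /pred0P/(_ (val x)) := dis.
  apply/adjP/adjP => [[x [y]]|[x [y [xh yh xy]]]].
    by rewrite !inE => -[? ? ?]; exists (val x), (val y).
  exists (Sub x (ne h x xh)), (Sub y (ne h' y yh)).
  by rewrite !inE !SubK; split; rewrite // /sedge /= /del_edge /= !SubK.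
Qed.

Lemma model_contract (H G : sgraph) (M : H -> {set G}) (h0 : H) (u v : G) :
    model M -> u \in M h0 -> v \in M h0 -> u -- v ->
  model (fun h => [set x : contract u v | val x \in M h]).
Proof.
move=> [M0 Mc Md] uM vM uv.
have nuv : u != v by apply: contraTneq uv => ->; rewrite sedge_irrefl.
(* The contraction map: [insubd] sends [v] to the default value [u] and fixes every other vertex. *)
pose f x : contract u v := insubd (Sub u nuv : contract u v) x.
have fv : val (f v) = u by rewrite val_insubd eqxx.
have fn x : x != v -> val (f x) = x by move=> xv; rewrite val_insubd xv.
have memI x h h' : x \in M h -> x \in M h' -> h = h'.
  move=> xh xh'; apply/eqP; apply: contraT => /Md[/pred0P/(_ x)].
  by rewrite /= xh xh'.
have fM x h : (val (f x) \in M h) = (x \in M h).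
  have [->|xv] := eqVneq x v; last by rewrite fn.
  by rewrite fv; apply/idP/idP => [/(memI _ _ _ uM)|/(memI _ _ _ vM)] <-.
have fE x y : x -- y -> f x = f y \/ f x -- f y.
  move=> xy; have [->|nf] := eqVneq (f x) (f y); [by left|right].
  rewrite /sedge /= /contract_rel /= nf /=.
  have [xv|xv] := eqVneq x v; have [yv|yv] := eqVneq y v.
  - by move: xy; rewrite xv yv sedge_irrefl.
  - by move: xy; rewrite xv fv eqxx (fn y) //= => ->; rewrite orbT.
  - by move: xy; rewrite yv fv eqxx (fn x) //= sedge_sym => ->; rewrite !orbT.
  - by rewrite !fn ?xy.
have fval x : f (val x) = x by apply: val_inj; rewrite fn // (valP x).
have imE h : [set x : contract u v | val x \in M h] = f @: M h.
  apply/setP => x; rewrite inE; apply/idP/imsetP => [xh|[y yh ->]].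
    by exists (val x).
  by rewrite fM.
split=> [h|h|h h' hh'].
- have /set0Pn[x xh] := M0 h; apply/set0Pn; exists (f x).
  by rewrite inE fM.
- by rewrite imE; apply: conn_map (Mc h) => x y _ _; apply: fE.
- have [dis <-] := Md h h' hh'; split.
    by apply/pred0P => x; rewrite /= !inE; have /pred0P/(_ (val x)) := dis.
  apply/adjP/adjP => [[x [y]]|[x [y [xh yh xy]]]].
    rewrite !inE => -[xh yh]; rewrite {1}/sedge /= /contract_rel /= => /andP[_].
    case/or3P => [xy|/andP[/eqP xu vy]|/andP[/eqP yu vx]].
    + by exists (val x), (val y).
    + exists v, (val y); split=> //.
      by have <- : h0 = h by apply: memI uM _; rewrite -xu.
    + exists (val x), v; split=> //; last by rewrite sedge_sym.
      by have <- : h0 = h' by apply: memI uM _; rewrite -yu.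
  exists (f x), (f y); rewrite !inE !fM; split=> //.
  have [fxy|//] := fE x y xy; have: x \in M h' by rewrite -fM fxy fM.
  by move=> /(memI _ _ _ xh) hE; rewrite hE eqxx in hh'.
Qed.

(** Induction on the number of vertices: delete a vertex outside all branch sets, or else contract
    an edge inside a branch set with two vertices. When neither exists, the branch sets are
    singletons that cover [G]. *)
Lemma model_induced_minor (H G : sgraph) (M : H -> {set G}) :
  model M -> induced_minor H G.
Proof.
move: {2}#|G|.+1 (ltnSn #|G|) => n; elim: n G M => // n IH G M Gn mM.
have card_del (v : G) : #|{: {x : G | x != v}}| < n.
  rewrite card_sig (eq_card (B := predC1 v)) // cardC1.
  have: 0 < #|G| by apply/card_gt0P; exists v.
  by case: #|G| Gn.
have [/existsP[v /forallP vM]|/existsPn cov] :=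
    boolP [exists v, forall h, v \notin M h].
  apply: (@induced_minor_del _ _ v); apply: IH (model_del mM vM).
  exact: card_del.
have [/existsP[h /existsP[x /existsP[y /and3P[xh yh xy]]]]|/existsPn one] :=
    boolP [exists h, exists x, exists y, [&& x \in M h, y \in M h & x != y]].
  have [_ Mc _] := mM.
  have [||u [v [uh _ vh _ uv]]] := @conn_edge _ _ [set x] x y (Mc h) xh _ yh.
  - by rewrite inE.
  - by rewrite inE eq_sym.
  apply: (@induced_minor_contract _ _ u v uv).
  apply: IH (model_contract mM uh vh uv); exact: card_del.
apply: induced_minor_iso; apply: (model_iso mM) => [x|h x y xh yh].
  by have /forallPn[h /negPn] := cov x; exists h.
apply/eqP; apply: contraNT (one h) => xy.
by apply/existsP; exists x; apply/existsP; exists y; rewrite xh yh xy.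
Qed.

End Models.

(** * Wheels from cyclic sequences of sets *)

Section Wheel.
Variable G : sgraph.
Implicit Types (A B H : {set G}) (b : nat -> {set G}).

Lemma adjS A B A' B' : A \subset A' -> B \subset B' -> adj A B -> adj A' B'.
Proof.
move=> /subsetP sA /subsetP sB /adjP[x [y [xA yB xy]]]; apply/adjP.
by exists x, y; split; [apply: sA | apply: sB |].
Qed.

Definition itv b s n := \bigcup_(i < n | s <= i) b i.

Lemma mem_itv b s n x :
  reflect (exists i, s <= i < n /\ x \in b i) (x \in itv b s n).
Proof.
apply: (iffP bigcupP) => [[i si xi]|[i [/andP[si lin] xi]]].
  by exists i; rewrite si ltn_ord.
by exists (Ordinal lin).
Qed.

Lemma conn_itv b s n :
    (forall i, s <= i < n -> conn (b i)) ->
    (forall i, s <= i -> i.+1 < n -> adj (b i) (b i.+1)) ->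
  conn (itv b s n).
Proof.
elim: n => [|n IH] bc ba.
  by apply/connP => x y /mem_itv[i []]; lia.
have [ns|sn] := ltnP n s.
  by apply/connP => x y /mem_itv[i []]; lia.
have [{}sn|ns] := ltnP s n; last first.
  have -> : itv b s n.+1 = b n; last by apply: bc; lia.
  apply/setP => x; apply/mem_itv/idP => [[i []]|xn]; last by exists n;
    split=> //; lia.
  by have [->|] := eqVneq i n; first by []; lia.
have -> : itv b s n.+1 = itv b s n :|: b n.
  apply/setP => x; apply/mem_itv/setUP => [[i []]|[/mem_itv[i []]|xn]].
  - have [->|] := eqVneq i n; first by right.
    by move=> *; left; apply/mem_itv; exists i; split=> //; lia.
  - by move=> *; exists i; split=> //; lia.
  - by exists n; split=> //; lia.
apply: connU_adj; first by apply: IH => i *; [apply: bc|apply: ba]; lia.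
  by apply: bc; lia.
have := ba n.-1; rewrite prednK; last by lia.
move=> /(_ ltac:(lia) ltac:(lia)); apply: adjS => //.
by apply/subsetP => x xb; apply/mem_itv; exists n.-1; split=> //; lia.
Qed.

(** A chordless cycle of length [r] with its vertices blown up to connected sets, so that a
    component of [G - C] can serve as one place of the rim. *)
Definition cyclic_sets r b :=
  (forall i, i < r -> conn (b i)) /\
  (forall i j, i < j -> j < r -> [disjoint b i & b j] /\
     adj (b i) (b j) = (j == i.+1) || (i == 0) && (j == r.-1)).

(** Merging the rim into [l] consecutive blocks, each with a contact of [H], gives branch sets of
    the wheel with hub [H]. *)
Lemma wheel_minor l r b H :
    2 < l -> cyclic_sets r b -> conn H ->
    (forall i, i < r -> [disjoint H & b i]) ->
    l <= #|[set i : 'I_r | adj H (b i)]| ->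
  induced_minor (wheel l) G.
Proof.
move=> l3 [bc bb] cH dH lH.
have lr : l <= r by apply: leq_trans lH _; rewrite -[leqRHS]card_ord max_card.
(* Cut the cycle at the places where the hub is met: the block of [i] is the
   number of contacts up to [i], minus one, truncated to [0 .. l-1]. The sets
   before the first contact join block 0, so that no block wraps around. *)
pose hit i := adj H (b i); pose cnt i := \sum_(j < i.+1) (hit j : nat).
have cntS i : cnt i.+1 = cnt i + hit i.+1 by rewrite /cnt big_ord_recr.
have cnt0 : cnt 0 = hit 0 by rewrite /cnt big_ord_recr big_ord0.
have cntr : l <= cnt r.-1.
  rewrite /cnt prednK; last by lia.
  by rewrite -sum1dep_card big_mkcond /= in lH.
pose idx i := minn (cnt i).-1 l.-1.
have idx0 : idx 0 = 0 by rewrite /idx cnt0; case: (hit 0); rewrite /= min0n.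
have idxr : idx r.-1 = l.-1 by rewrite /idx; lia.
have idxS i : idx i <= idx i.+1 <= (idx i).+1.
  by rewrite /idx cntS; case: (hit i.+1) => /=; lia.
have idxm i j : i <= j -> idx i <= idx j.
  move=> ij; rewrite -(subnK ij); elim: (j - i) => // d IH.
  by rewrite addSn; have := idxS (d + i); lia.
(* The first [i] with [a < cnt i] is a contact in block [a]. For [0 < a] its predecessor lies in
   block [a.-1], so consecutive blocks are adjacent. *)
have first_hit a : a < l -> exists i,
    [/\ i < r, hit i, idx i = a & 0 < a -> 0 < i /\ idx i.-1 = a.-1].
  move=> al; have ex : exists i, a < cnt i by exists r.-1; lia.
  case: (ex_minnP ex) => -[|i] ai mini.
    exists 0; rewrite cnt0 in ai; case: (hit 0) ai => //= a0.
    by rewrite idx0; split=> //; lia.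
  have ci : cnt i <= a by rewrite leqNgt; apply/negP => /mini; rewrite ltnn.
  rewrite cntS in ai; exists i.+1; rewrite /idx cntS.
  have ir : i.+1 <= r.-1 by apply: mini; lia.
  by case: (hit i.+1) ai; split=> //=; lia.
pose M (h : wheel l) := if h is Some a
  then [set x | [exists i : 'I_r, (idx i == a) && (x \in b i)]] else H.
have memM (a : 'I_l) x :
    reflect (exists i, [/\ i < r, idx i = a & x \in b i]) (x \in M (Some a)).
  rewrite inE; apply: (iffP existsP) => [[i /andP[/eqP ia xi]]|[i [ir ia xi]]].
    by exists i.
  by exists (Ordinal ir); rewrite /= ia eqxx.
have subM (a : 'I_l) i : i < r -> idx i = a -> b i \subset M (Some a).
  by move=> ir ia; apply/subsetP => x xi; apply/memM; exists i.
have badj i : i.+1 < r -> adj (b i) (b i.+1).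
  by move=> ir; rewrite (proj2 (bb _ _ (ltnSn i) ir)) eqxx.
have adjM (a a' : 'I_l) : a < a' ->
    adj (M (Some a)) (M (Some a')) = (a' == a.+1 :> nat) || (a == 0 :> nat) &&
      (a' == l.-1 :> nat).
  move=> aa'; apply/adjP/idP =>
    [[x [y [/memM[i [ir ia xi]] /memM[j [jr ja yj]] xy]]]|].
    have ij : i < j by rewrite ltnNge; apply/negP => /idxm; lia.
    have : adj (b i) (b j) by apply/adjP; exists x, y.
    rewrite (proj2 (bb _ _ ij jr)) => /orP[/eqP jE|/andP[/eqP i0 /eqP jE]].
      by have := idxS i; rewrite -jE; lia.
    by move: ia ja; rewrite i0 jE idx0 idxr => <- <-; rewrite !eqxx orbT.
  move=> edge; apply/adjP; case/orP: edge => [/eqP aE|/andP[/eqP a0 /eqP aE]].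
    have [i [ir _ ia []]] := first_hit a' (ltn_ord a'); first by lia.
    move=> i0 ia'; have := badj i.-1; rewrite prednK // => /(_ ir).
    by apply: adjS; apply: subM => //; lia.
  have : adj (b 0) (b r.-1) by rewrite (proj2 (bb 0 r.-1 _ _)) ?eqxx ?orbT; lia.
  by apply: adjS; apply: subM; lia.
have disM (a a' : 'I_l) : a < a' -> [disjoint M (Some a) & M (Some a')].
  move=> aa'; apply/pred0P => x; apply/negP => /andP[].
  move=> /memM[i [ir ia xi]] /memM[j [jr ja xj]].
  have ij : i < j by rewrite ltnNge; apply/negP => /idxm; lia.
  by have [/pred0P/(_ x)] := bb _ _ ij jr; rewrite /= xi xj.
have disH (a : 'I_l) : [disjoint H & M (Some a)].
  apply/pred0P => x; apply/negP => /= /andP[xH /memM[i [ir _ xi]]].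
  by have /pred0P/(_ x) := dH i ir; rewrite /= xH xi.
have adjH (a : 'I_l) : adj H (M (Some a)).
  have [i [ir hi ia _]] := first_hit a (ltn_ord a).
  by apply: adjS hi => //; apply: subM.
(* [ordS] is the successor modulo [l]; as [a < a'], it can wrap around only at [a' = l.-1]. *)
have ordSE (a a' : 'I_l) : a < a' ->
    (a' == ordS a) || (a == ordS a')
      = (a' == a.+1 :> nat) || (a == 0 :> nat) && (a' == l.-1 :> nat).
  move=> aa'; have := ltn_ord a'; rewrite -!(inj_eq val_inj) /= => a'l.
  rewrite modn_small; last by lia.
  have [->|a'n] := eqVneq (a' : nat) l.-1; last by rewrite modn_small; lia.
  by rewrite prednK ?modnn; lia.
apply: (@model_induced_minor (wheel l) G M); split.
- move=> [a|].
    have /adjP[x [y [_ yM _]]] := adjH a; by apply/set0Pn; exists y.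
  have /adjP[x [y [xH _ _]]] :=
    adjH (Ordinal (ltn_trans (ltn_trans (ltn0Sn _) (ltnSn 1)) l3)).
  by apply/set0Pn; exists x.
- move=> [a|] //; apply/connP => x y /memM[i [ir ia xi]] /memM[j [jr ja yj]].
  wlog ij : x y i j ir ia xi jr ja yj / i <= j.
    move=> th; case/orP: (leq_total i j) => [|ji];
      first exact: th ia xi jr ja yj.
    by rewrite (sym_connect_sym (@inside_sym _ _)); apply: th ji.
  (* All indices between [i] and [j] belong to the same block, because [idx] is monotone. *)
  have /connP c : conn (itv b i j.+1).
    by apply: conn_itv => k *; [apply: bc|apply: badj]; lia.
  apply: (@connect_insideS _ (itv b i j.+1)).
    apply/subsetP => z /mem_itv[k [/andP[ik kj] zk]]; apply/memM; exists k.
    by have := idxm _ _ ik; have := idxm k j kj; split=> //; lia.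
  by apply: c; apply/mem_itv; [exists i|exists j]; split=> //; lia.
- move=> [a|] [a'|] //= hh'.
  + have {hh'}: a != a' by apply: contraNneq hh' => ->.
    wlog aa' : a a' / a < a' => [th nn|_].
      case: (ltngtP a a') => [/th/(_ nn) //|/th|/val_inj aE];
        last by rewrite aE eqxx in nn.
      rewrite eq_sym => /(_ nn)[d e]; rewrite disjoint_sym adjC {}e; split=> //.
      by congr (_ && _); rewrite orbC.
    have -> : a != a' by rewrite -(inj_eq val_inj) /=; lia.
    by split; [apply: disM|rewrite ordSE // -adjM].
  + by rewrite disjoint_sym adjC adjH; split=> //; apply: disH.
  + by rewrite adjH; split=> //; apply: disH.
Qed.

End Wheel.

(** * The big component *)

Section BigComponent.
Variable G : sgraph.
Implicit Types (A D S : {set G}) (x y : G).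

Definition big A := #|G| < 2 * #|A|.

(* Two sets with more than half of the vertices meet, so this union is the
   component of G - S with more than half of the vertices, or empty. *)
Definition beta S :=
  \bigcup_(A : {set G} | [&& conn A, big A & [disjoint A & S]]) A.

Lemma mem_beta S x :
  reflect (exists A, [/\ conn A, big A, [disjoint A & S] & x \in A])
          (x \in beta S).
Proof.
by apply: (iffP bigcupP) => [[A /and3P[]]|[A [*]]]; exists A => //; apply/and3P.
Qed.

Lemma big_meet A B : big A -> big B -> exists x, x \in A /\ x \in B.
Proof.
rewrite /big => bA bB; have: A :&: B != set0.
  rewrite -card_gt0; have := cardsUI A B.
  have: #|A :|: B| <= #|G| by apply: max_card.
  by move: #|A| #|B| #|G| #|_ :|: _| #|_ :&: _| bA bB; lia.
by case/set0Pn=> x /setIP[]; exists x.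
Qed.

Lemma beta_sub S A : conn A -> big A -> [disjoint A & S] -> A \subset beta S.
Proof. by move=> *; apply/subsetP => x xA; apply/mem_beta; exists A. Qed.

Lemma beta_notin S x : x \in beta S -> x \notin S.
Proof.
case/mem_beta=> A [_ _ dA xA]; apply/negP => xS.
by have /pred0P/(_ x) := dA; rewrite /= xA xS.
Qed.

Lemma beta_disjoint S : [disjoint beta S & S].
Proof.
by apply/pred0P => x /=; apply/andP => -[/beta_notin/negP].
Qed.

Lemma beta_conn S : conn (beta S).
Proof.
apply/connP => x y /mem_beta[A [cA bA dA xA]] /mem_beta[B [cB bB dB yB]].
have [z [zA zB]] := big_meet bA bB.
have /connP c := connU cA cB zA zB.
apply: connect_insideS (c x y _ _); rewrite ?inE ?xA ?yB ?orbT //.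
by rewrite subUset !beta_sub.
Qed.

Lemma beta_big S : beta S != set0 -> big (beta S).
Proof.
case/set0Pn=> x /mem_beta[A [cA bA dA _]].
by rewrite /big (leq_trans bA) // leq_mul2l subset_leq_card // beta_sub.
Qed.

Lemma beta_subS S S' : S \subset S' -> beta S' \subset beta S.
Proof.
move=> sS; apply/subsetP => x /mem_beta[A [cA bA dA xA]]; apply/mem_beta.
by exists A; split=> //; rewrite disjoint_sym (disjointWl sS) // disjoint_sym.
Qed.

Lemma beta_meet S S' :
  beta S != set0 -> beta S' != set0 -> exists x, x \in beta S /\ x \in beta S'.
Proof. by move=> /beta_big bS /beta_big; apply: big_meet. Qed.

Lemma beta_closed S x y : x \in beta S -> x -- y -> y \notin S -> y \in beta S.
Proof.
case/mem_beta=> A [cA bA dA xA] xy yS; apply/mem_beta; exists (A :|: [set y]).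
split; last by rewrite !inE eqxx orbT.
- by apply: connU_adj; rewrite ?conn1 //; apply/adjP; exists x, y;
    rewrite set11.
- by rewrite /big (leq_trans bA) // leq_mul2l subset_leq_card // subsetUl.
- apply/pred0P => z; apply/negP => /= /andP[/setUP[zA|/set1P->] zS].
    by have /pred0P/(_ z) := dA; rewrite /= zA zS.
  by rewrite zS in yS.
Qed.

(** A component of [G - S] with more than half of the vertices would be one of the sets in the union
    [beta S]. *)
Lemma beta0_balanced S : beta S = set0 -> balanced_separator S.
Proof.
move=> b0 C /imsetP[x xS ->]; rewrite leqNgt; apply/negP => bC.
set A := [set _ in _ | _] in bC.
have AE : A = [set y | connect (avoiding S) x y].
  apply/setP => y; rewrite !inE andb_idl // => xy.
  apply: (connect_ind (P := fun z => z \notin S) xy) => [|u v _ /and3P[] //].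
  by rewrite inE in xS.
have cA : conn A by rewrite AE; apply: conn_class => u v /and3P[].
have xA : x \in A by rewrite AE inE.
have: x \in beta S.
  apply/mem_beta; exists A; split=> //.
  by apply/pred0P => z /=; rewrite !inE; case: (z \in S) => //=; rewrite andbF.
by rewrite b0 inE.
Qed.

Lemma in_closed_neigh A y :
  reflect (exists2 x, x \in A & x = y \/ x -- y) (y \in closed_neigh A).
Proof.
rewrite !inE; apply: (iffP orP) => [[yA|/exists_inP[x xA xy]]|[x xA [<-|xy]]].
- by exists y; [|left].
- by exists x; [|right].
- by left.
- by right; apply/exists_inP; exists x.
Qed.

Lemma closed_neighS A A' :
  A \subset A' -> closed_neigh A \subset closed_neigh A'.
Proof.
move=> /subsetP sA; apply/subsetP => y /in_closed_neigh[x /sA xA xy].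
by apply/in_closed_neigh; exists x.
Qed.

Lemma sub_closed_neigh A : A \subset closed_neigh A.
Proof. exact: subsetUl. Qed.

End BigComponent.

(** * Induced cycles are not balanced separators *)

Section Cycles.
Variables (l : nat) (G : sgraph).
Hypothesis l3 : 2 < l.
Hypothesis Wfree : induced_minor_free (wheel l) G.
Variables (r : nat) (c : nat -> G).
Implicit Types (A D K H : {set G}) (x y : G) (i j k m : nat).

(** Edges and non-edges are both prescribed, which makes the cycle chordless. Only the values of [c]
    below [r] count. *)
Definition icycle := forall i j, i < j -> j < r ->
  c i != c j /\ (c i -- c j) = (j == i.+1) || (i == 0) && (j == r.-1).

Hypothesis cycC : icycle.

Definition cyc := [set c i | i : 'I_r].

Definition att K i := adj K [set c i].

Lemma mem_cyc x : reflect (exists2 i, i < r & x = c i) (x \in cyc).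
Proof.
apply: (iffP imsetP) => [[i _ ->]|[i ir ->]]; first by exists i.
by exists (Ordinal ir).
Qed.

Lemma attP K i : reflect (exists2 x, x \in K & x -- c i) (att K i).
Proof.
apply: (iffP (adjP _ _)) => [[x [y [xK /set1P-> xy]]]|[x xK xi]].
  by exists x.
by exists x, (c i); rewrite set11.
Qed.

Lemma cyc_inj i j : i < r -> j < r -> c i = c j -> i = j.
Proof.
move=> ir jr cij; case: (ltngtP i j) => // [ij|ji].
  by have [/eqP] := cycC ij jr.
by have [/eqP] := cycC ji ir; rewrite cij.
Qed.

Lemma cyc_edge i j : i < r -> j < r -> c i -- c j ->
  [|| j == i.+1, i == j.+1, (i == 0) && (j == r.-1) | (j == 0) && (i == r.-1)].
Proof.
move=> ir jr; case: (ltngtP i j) => [ij|ji|->]; last by rewrite sedge_irrefl.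
  by have [_ ->] := cycC ij jr => /orP[] ->; rewrite ?orbT.
by rewrite sedge_sym; have [_ ->] := cycC ji ir => /orP[] ->; rewrite ?orbT.
Qed.

(** Otherwise the cycle as rim and [H] as hub contract to the wheel. *)
Lemma few_att H :
  conn H -> [disjoint H & cyc] -> #|[set i : 'I_r | att H i]| < l.
Proof.
move=> cH dH; rewrite ltnNge; apply/negP => lH; apply: Wfree.
apply: (@wheel_minor G l r (fun i => [set c i]) H) => //.
- split=> [i _|i j ij jr]; first exact: conn1.
  have [nij <-] := cycC ij jr; split.
    by rewrite disjoints1 inE.
  by apply/adjP/idP => [[x [y [/set1P-> /set1P->]]] //|]; exists (c i), (c j);
    rewrite !set11.
- move=> i ir; rewrite disjoint_sym disjoints1; apply/negP => iH.
  by have /pred0P/(_ (c i)) := dH; rewrite /= iH; case: mem_cyc => // -[];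
    exists i.
Qed.

(** For [x] outside [W], the component of [G - W] that contains [x]; for [x] in [W] it degenerates
    to [{x}]. *)
Definition class W x := [set y | connect (inside (~: W)) x y].

Definition comp x := class cyc x.

Lemma class_conn (W : {set G}) x : conn (class W x).
Proof. by apply: conn_class => u v /and3P[]. Qed.

Lemma class_sub (W : {set G}) A x :
  conn A -> [disjoint A & W] -> x \in A -> A \subset class W x.
Proof.
move=> /connP cA dA xA; apply/subsetP => y yA; rewrite inE.
by apply: connect_insideS (cA x y xA yA); rewrite -disjoints_subset.
Qed.

Lemma class_disjoint (W : {set G}) x : x \notin W -> [disjoint class W x & W].
Proof.
move=> xW; rewrite disjoints_subset; apply/subsetP => y; rewrite inE => xy.
apply: (connect_ind (P := fun z => z \in ~: W) xy); first by rewrite inE.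
by move=> u v _ /and3P[].
Qed.

Lemma class_closed (W : {set G}) x y z :
  x \notin W -> y \in class W x -> y -- z -> z \notin W -> z \in class W x.
Proof.
move=> xW yx yz zW; have /pred0P/(_ y) := class_disjoint xW.
move=> /=; rewrite yx /= => yW; rewrite inE in yx; rewrite inE.
by apply: connect_trans yx (connect1 _); rewrite /inside /= !inE yW zW.
Qed.

Lemma class_self (W : {set G}) x : x \in class W x.
Proof. by rewrite inE. Qed.

Lemma class_eq (W : {set G}) x y : y \in class W x -> class W y = class W x.
Proof.
rewrite inE => xy; apply/setP => z; rewrite !inE; apply/idP/idP.
  exact: connect_trans.
by apply: connect_trans; rewrite (sym_connect_sym (@inside_sym _ _)).
Qed.

(** No edge of the cycle joins the [X] part to the [Y] part, so [A] can pass from one to the other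
    only through a component of [G - C] with contacts in both. *)
Lemma crossing A (X Y : pred nat) i j :
    conn A -> i < r -> j < r -> c i \in A -> c j \in A -> X i -> Y j ->
    (forall k, k < r -> c k \in A -> X k || Y k) ->
    (forall k m, k < r -> m < r -> X k -> Y m -> k <> m /\ ~~ (c k -- c m)) ->
  exists x k m, [/\ x \notin cyc, k < r /\ m < r, c k \in A /\ c m \in A,
    X k /\ Y m & att (comp x) k /\ att (comp x) m].
Proof.
move=> cA ir jr iA jA Xi Yj XY anti.
(* The [X] vertices of the cycle in [A], with all components that have a contact among them. An edge
   of [A] that leaves [Z] must run from such a component to a [Y] vertex. *)
pose Z := [set z | [exists k : 'I_r, [&& X k, c k \in A &
  (z == c k) || (z \notin cyc) && att (comp z) k]]].
have memZ z k : k < r -> X k -> c k \in A ->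
    z = c k \/ z \notin cyc /\ att (comp z) k -> z \in Z.
  move=> kr Xk kA zk; rewrite inE; apply/existsP; exists (Ordinal kr).
  by rewrite /= Xk kA /=; apply/orP; case: zk => [->|[-> ->]]; [left|right].
have iZ : c i \in Z by apply: (memZ _ i) => //; left.
have jZ : c j \notin Z.
  rewrite inE; apply/existsP => -[k /and3P[Xk kA /orP[/eqP jk|/andP[/negP[]]]]].
    by have [[]] := anti k j (ltn_ord k) jr Xk Yj; apply: cyc_inj.
  by apply/mem_cyc; exists j.
have [u [v [uA uZ vA vZ uv]]] := conn_edge cA iA iZ jA jZ.
move: (uZ); rewrite inE => /existsP[[k kr] /= /and3P[Xk kA uk]].
have [/mem_cyc[m mr vm]|vcyc] := boolP (v \in cyc).
  have Ym : Y m.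
    have := XY m mr; rewrite -vm vA => /(_ isT)/orP[Xm|//].
    by case/negP: vZ; apply: (memZ v m) => //; [rewrite -vm|left].
  have [_] := anti k m kr mr Xk Ym.
  case/orP: uk => [/eqP <-|/andP[ucyc uk] _]; first by rewrite -vm uv.
  exists u, k, m; rewrite -vm; split=> //; split=> //.
  by apply/attP; exists u; rewrite ?class_self // -vm.
case/negP: vZ; apply: (memZ v k) => //; right; split=> //.
case/orP: uk => [/eqP uE|/andP[ucyc uk]].
  by apply/attP; exists v; rewrite ?class_self // sedge_sym -uE.
have vu : v \in comp u by apply: class_closed ucyc (class_self _ _) uv vcyc.
by rewrite /comp (class_eq vu).
Qed.

Lemma cyc_itv_conn m n : n <= r -> conn (itv (fun i => [set c i]) m n).
Proof.
move=> nr; apply: conn_itv => [i _|i mi iN]; first exact: conn1.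
apply/adjP; exists (c i), (c i.+1); rewrite !set11; split=> //.
by have [_ ->] := cycC (ltnSn i) (leq_trans iN nr); rewrite eqxx.
Qed.

(** * Separating an arc of the cycle from the rest *)

Definition outside f g := [set c j | j : 'I_r & ~~ (f <= j <= g)].

Lemma mem_outside f g x :
  reflect (exists j, [/\ j < r, ~~ (f <= j <= g) & x = c j]) (x \in outside f
    g).
Proof.
apply: (iffP imsetP) => [[j jfg ->]|[j [jr jfg ->]]].
  by rewrite inE in jfg; exists j.
by exists (Ordinal jr); rewrite ?inE.
Qed.

(** The complement of an arc is again an arc: when both are nonempty, the pieces before [f] and
    after [g] are joined by the edge from [c 0] to [c r.-1]. *)
Lemma outside_conn f g : f <= g -> g < r -> conn (outside f g).
Proof.
move=> fg gr.
have -> : outside f g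
    = itv (fun i => [set c i]) 0 f :|: itv (fun i => [set c i]) g.+1 r.
  apply/setP => x; apply/mem_outside/setUP => [[j [jr jfg ->]]|].
    have [jf|fj] := ltnP j f.
      by left; apply/mem_itv; exists j; rewrite set11.
    by right; apply/mem_itv; exists j; rewrite set11; split=> //; lia.
  by case=> /mem_itv[j [jI /set1P->]]; exists j; split=> //; lia.
have [->|f0] := posnP f.
  rewrite (_ : itv _ 0 0 = set0) ?set0U ?cyc_itv_conn //.
  by apply/setP => x; rewrite inE; apply/mem_itv => -[i []].
have [gE|gN] := eqVneq g r.-1.
  rewrite [itv _ g.+1 r](_ : _ = set0) ?setU0 ?cyc_itv_conn //; first by lia.
  by apply/setP => x; rewrite inE; apply/mem_itv => -[i []]; lia.
apply: connU_adj; rewrite ?cyc_itv_conn //; first by lia.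
apply/adjP; exists (c 0), (c r.-1); split.
- by apply/mem_itv; exists 0; rewrite set11; split=> //; lia.
- by apply/mem_itv; exists r.-1; rewrite set11; split=> //; lia.
- by have [||_ ->] := @cycC 0 r.-1; rewrite ?eqxx ?orbT //; lia.
Qed.

(** The arc from [c u] to [c v] occupies the places [0] to [v - u], and [K] closes it at place
    [(v - u).+1]. *)
Definition arc_sets u v K t := if t <= v - u then [set c (u + t)] else K.

(** [K] sees only the two ends of the arc, and these are not joined around the cycle because [u = 0]
    and [v = r.-1] do not hold together. *)
Lemma arc_cyclic_sets u v K :
    conn K -> [disjoint K & cyc] -> u < v < r -> ~~ ((u == 0) && (v == r.-1)) ->
    att K u -> att K v -> (forall k, u < k < v -> ~~ att K k) ->
  cyclic_sets (v - u).+2 (arc_sets u v K).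
Proof.
move=> cK dK /andP[uv vr] nuv au av noatt.
have notK k : k < r -> c k \notin K.
  move=> kr; apply/negP => kK; have /pred0P/(_ (c k)) := dK.
  by rewrite /= kK; case: mem_cyc => // -[]; exists k.
split=> [t _|s t st tr]; rewrite /arc_sets.
  by case: ifP => _; first exact: conn1.
have sv : s <= v - u by clear -st tr; lia.
rewrite sv; case: leqP => tv.
  have utr : u + t < r by clear -tv uv vr; lia.
  have [|nst e] := @cycC (u + s) (u + t) _ utr; first by rewrite ltn_add2l.
  split; first by rewrite disjoints1 inE.
  have -> : adj [set c (u + s)] [set c (u + t)] = (c (u + s) -- c (u + t)).
    apply/adjP/idP => [[? [? [/set1P-> /set1P->]]] //|].
    by exists (c (u + s)), (c (u + t)); rewrite !set11.
  rewrite e -addnS eqn_add2l addn_eq0.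
  have -> : (t == (v - u).+2.-1) = false by clear -tv; lia.
  rewrite andbF; case: (s == 0); rewrite ?andbF ?andbT //.
  congr (_ || _); apply: contraNF nuv => /andP[/eqP u0 /eqP uE].
  by rewrite u0 eqxx /=; clear -uE tv uv vr u0; lia.
have usr : u + s < r by clear -sv uv vr; lia.
split; first by rewrite disjoints1 notK.
rewrite adjC -/(att K (u + s)); have -> : t = (v - u).+1 by clear -tr tv; lia.
rewrite eqxx andbT eqSS; have [->|s0] := eqVneq s 0.
  by rewrite addn0 au orbT.
have [<-|nsv] := eqVneq (v - u) s; first by rewrite subnKC ?av // ltnW.
by apply/negbTE/noatt; clear -s0 nsv sv uv; lia.
Qed.

(* One can leave the arc [f, g] from position i through a component of G - C
   other than K. *)
Definition crosses K f g i := [&& f < i < g, ~~ att K i &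
  [exists y : G, [&& y \notin cyc, y \notin K, att (comp y) i &
    [exists j : 'I_r, ~~ (f <= j <= g) && att (comp y) j]]]].

(* The cycle c_u, ..., c_v, K meets a hub made of the rest of C and of the
   components of G - C used for crossing. *)
Lemma few_crosses x f g u v : x \notin cyc ->
    f <= u -> v <= g -> g < r -> u < v -> att (comp x) u -> att (comp x) v ->
    (forall k, u < k < v -> ~~ att (comp x) k) ->
  #|[set i : 'I_r | crosses (comp x) f g i && (u < i < v)]| < l.
Proof.
move=> xcyc fu vg gr uv au av noatt; set E := [set i | _]; set K := comp x.
have [->|[i0 i0E]] := set_0Vmem E; first by rewrite cards0; lia.
have [j0 j0r j0fg] : exists2 j, j < r & ~~ (f <= j <= g).
  move: i0E; rewrite inE => /andP[/and3P[_ _ /existsP[y]]].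
  by case/and4P=> _ _ _ /existsP[j /andP[jfg _]]; exists j.
have dK : [disjoint K & cyc] := class_disjoint xcyc.
pose W := K :|: [set c k | k : 'I_r & u <= k <= v].
have memW z : z \in W -> z \in K \/ exists k, [/\ k < r, u <= k <= v & z = c k].
  case/setUP=> [|/imsetP[k]]; first by left.
  by rewrite inE => ? ->; right; exists k.
have dO : [disjoint outside f g & W].
  apply/pred0P => z; apply/negP => /= /andP[/mem_outside[j [jr jfg zj]]].
  case/memW=> [zK|[k [kr kuv]]].
    have /pred0P/(_ z) := dK; rewrite /= zK zj.
    by case: mem_cyc => // -[]; exists j.
  rewrite zj => /cyc_inj jk; move: jfg; rewrite jk // => /negP[].
  by clear -kuv fu vg; lia.
have j0O : c j0 \in outside f g by apply/mem_outside; exists j0.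
have j0W : c j0 \notin W.
  by apply/negP => j0W; have /pred0P/(_ (c j0)) := dO; rewrite /= j0O j0W.
(* [W] contains the rim. The hub [H] contains the outside of [[f, g]], hence also each component
   used for crossing, since that component avoids [W] and has a contact outside. *)
pose H := class W (c j0).
have fg : f <= g by clear -fu vg uv; lia.
have nuv : ~~ ((u == 0) && (v == r.-1)).
  by clear -j0r j0fg fu vg gr; lia.
clear j0r j0fg.
have OH : outside f g \subset H := class_sub (outside_conn fg gr) dO j0O.
have dH : [disjoint H & W] := class_disjoint j0W.
have vr : v < r by apply: leq_ltn_trans gr.
rewrite ltnNge; apply/negP => lE; apply: Wfree.
apply: (@wheel_minor G l (v - u).+2 (arc_sets u v K) H) => //.
- by apply: arc_cyclic_sets => //; rewrite ?uv //; apply: class_conn.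
- exact: class_conn.
- move=> t tr; apply/pred0P => z; apply/negP => /= /andP[zH zb].
  have /pred0P/(_ z) := dH; rewrite /= zH /= => /negP[]; move: zb;
    rewrite /arc_sets.
  case: leqP => [tv /set1P->|_ zK]; last by rewrite inE zK.
  have utr : u + t < r by clear -tv uv vr; lia.
  apply/setUP; right; apply/imsetP; exists (Ordinal utr) => //.
  by rewrite inE /=; clear -tv uv; lia.
apply: leq_trans lE _; pose h (i : 'I_r) : 'I_(v - u).+2 := inord (i - u).
have hE (i : 'I_r) : i \in E -> h i = i - u :> nat.
  by rewrite inE => /andP[_ iuv]; rewrite inordK //; clear -iuv; lia.
have hinj : {in E &, injective h}.
  move=> i i' iE iE' /(congr1 val) /=; rewrite !hE // => e;
    apply: val_inj => /=.
  by move: iE iE'; rewrite !inE => /andP[_ iuv] /andP[_ iuv'];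
    clear -e iuv iuv'; lia.
rewrite -(card_in_imset hinj); apply: subset_leq_card.
apply/subsetP => _ /imsetP[i iE ->]; rewrite inE hE //.
move: iE; rewrite inE => /andP[/and3P[_ ai /existsP[y]]].
case/and4P=> ycyc yK ayi /existsP[j /andP[jfg ayj]] iuv.
rewrite /arc_sets ifT; last by clear -iuv; lia.
rewrite subnKC; last by clear -iuv; lia.
have dy : [disjoint comp y & W].
  apply/pred0P => z; apply/negP => /= /andP[zy /memW[zK|[k [kr _ zk]]]].
    by move: yK; rewrite /comp -(class_eq zK) (class_eq zy) class_self.
  have /pred0P/(_ z) := class_disjoint ycyc; rewrite /= zy zk.
  by case: mem_cyc => // -[]; exists k.
have [w wy wj] := attP _ _ ayj.
have wH : w \in H.
  apply: (class_closed (y := c j)) => //; last 2 first.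
  - by rewrite sedge_sym.
  - by apply/negP => wW; have /pred0P/(_ w) := dy; rewrite /= wy wW.
  by apply: (subsetP OH); apply/mem_outside; exists j.
have yH : comp y \subset H.
  by rewrite /H -(class_eq wH); apply: class_sub; rewrite ?class_conn.
by have [z zy zi] := attP _ _ ayi; apply/attP; exists z => //;
  apply: (subsetP yH).
Qed.

(** [D] consists of the contacts [F] of [K] and the crossing positions [E]. A connected set that
    leaves the open arc and avoids [F] must use a component other than [K], hence starts from a
    position in [E]. *)
Lemma chord_separation x f g : x \notin cyc -> f < g -> g < r ->
    att (comp x) f -> att (comp x) g ->
  exists D, [/\ #|D| <= l * l + l, c f \in D, c g \in D &
    forall A, conn A -> [disjoint A & D] -> forall i j, f < i < g -> j < r ->
      c i \in A -> c j \in A -> f < j < g].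
Proof.
move=> xcyc fg gr af ag; set K := comp x.
pose F := [set i : 'I_r | att K i].
pose E := [set i : 'I_r | crosses K f g i].
have Fl : #|F| < l by apply: few_att; [apply: class_conn|apply: class_disjoint].
(* The crossing positions whose last preceding contact of [K] is [u]. Each class is bounded by
   [few_crosses] and there are fewer than [l] contacts, whence [l * l]. *)
pose Eu (u : 'I_r) := [set i in E | (u < i) &&
  [forall k : 'I_r, att K k ==> (k <= u) || (i <= k)]].
have Eul u : u \in F -> #|Eu u| <= l.
  rewrite inE => au; have [->|[i0]] := set_0Vmem (Eu u);
    first by rewrite cards0.
  rewrite !inE => /andP[/and3P[fi0g ai0 _] /andP[ui0 /forallP i0P]].
  have fr : f < r by lia.
  have fu : f <= u by have /implyP/(_ af)/= := i0P (Ordinal fr); lia.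
  have exv : exists v, (i0 < v) && att K v by exists g; rewrite ag; lia.
  case: (ex_minnP exv) => v /andP[i0v av] vmin.
  have vg : v <= g by apply: vmin; rewrite ag; lia.
  apply: ltnW; apply: leq_ltn_trans (few_crosses xcyc fu vg gr _ au av _).
  - apply: subset_leq_card; apply/subsetP => i; rewrite !inE.
    case/andP=> Ei /andP[ui /forallP iP]; rewrite Ei ui /=.
    have vr : v < r by lia.
    have /implyP/(_ av)/= := iP (Ordinal vr).
    have [iv|//] := eqVneq (i : nat) v; last by lia.
    by move: Ei; rewrite /crosses iv /K av andbF.
  - by lia.
  - move=> k /andP[uk kv]; apply/negP => ak; have kr : k < r by lia.
    have /implyP/(_ ak)/= := i0P (Ordinal kr); rewrite leqNgt uk /= => i0k.
    have [i0E|ni0k] := eqVneq (i0 : nat) k; first by rewrite i0E ak in ai0.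
    by have := vmin k; rewrite ak andbT; lia.
have El : #|E| <= l * l.
  have sub : E \subset \bigcup_(u in F) Eu u.
    apply/subsetP => i iE; have := iE; rewrite inE => /and3P[fig ai _].
    have exu : exists u, (u < i) && att K u by exists f; rewrite af; lia.
    have ub u : (u < i) && att K u -> u <= i by lia.
    case: (ex_maxnP exu ub) => u /andP[ui au] umax.
    have ur : u < r by have := ltn_ord i; lia.
    apply/bigcupP; exists (Ordinal ur); rewrite inE // iE ui /=.
    apply/forallP => k; apply/implyP => ak.
    by have := umax k; rewrite ak andbT; lia.
  apply: leq_trans (subset_leq_card sub) _.
  apply: leq_trans (_ : \sum_(u in F) #|Eu u| <= _).
    elim/big_rec2: _ => [|u n A uF IH]; first by rewrite cards0.
    by apply: leq_trans (leq_card_setU _ _) _; rewrite leq_add2l.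
  apply: leq_trans (_ : \sum_(u in F) l <= _); first exact: leq_sum.
  by rewrite sum_nat_const leq_mul2r ltnW // orbT.
have inD k : k < r -> att K k || crosses K f g k ->
    c k \in [set c (nat_of_ord i) | i in E :|: F].
  move=> kr ak; apply/imsetP; exists (Ordinal kr) => //.
  by rewrite !inE orbC.
exists [set c (nat_of_ord i) | i in E :|: F]; split.
- apply: leq_trans (leq_imset_card _ _) (leq_trans (leq_card_setU _ _) _).
  by rewrite leq_add // ltnW.
- by apply: inD; rewrite ?af //; lia.
- by apply: inD; rewrite ?ag //; lia.
move=> A cA dA i j fig jr iA jA.
have notA k : k < r -> att K k || crosses K f g k -> c k \notin A.
  move=> kr /(inD k kr) kD; apply/negP => kA.
  by have /pred0P/(_ (c k)) := dA; rewrite /= kA kD.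
apply: contraT => jfg.
pose X k := f < k < g; pose Y k := ~~ (f <= k <= g).
have ir : i < r by lia.
have ends k : c k \in A -> k != f /\ k != g.
  move=> kA; split; apply: contraTneq kA => ->; apply: notA; rewrite ?af ?ag //.
  by lia.
have Yj : Y j by have := ends j jA; rewrite /Y; lia.
have [||y [k [m [ycyc [kr mr] [kA mA] [Xk Ym] [ak am]]]]] :=
    @crossing A X Y i j cA ir jr iA jA fig Yj.
- by move=> k kr kA; have := ends k kA; rewrite /X /Y; lia.
- move=> k m kr mr Xk Ym; split; first by move: Xk Ym; rewrite /X /Y; lia.
  by apply/negP => /(cyc_edge kr mr); move: Xk Ym; rewrite /X /Y; lia.
have nak : ~~ att K k by apply/negP => kK; have := notA k kr;
  rewrite kK kA => /(_ isT).
suff: c k \notin A by rewrite kA.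
apply: notA => //; apply/orP; right; apply/and3P; split=> //.
apply/existsP; exists y; rewrite ycyc ak /=; apply/andP; split.
  by apply: contra nak => yK; rewrite /K /comp -(class_eq yK).
by apply/existsP; exists (Ordinal mr); rewrite /= am andbT.
Qed.

(** * The trace of the big component on the cycle *)

Definition bound := l * l + l.

Definition big_at D i := (i < r) && (c i \in beta (closed_neigh D)).

Lemma big_atS D D' i : D \subset D' -> big_at D' i -> big_at D i.
Proof.
move=> sD /andP[ir iD]; rewrite /big_at ir /=.
exact: (subsetP (beta_subS (closed_neighS sD))).
Qed.

Lemma big_at_notin D i : big_at D i -> c i \notin D.
Proof.
case/andP=> _ /beta_notin; apply: contra => /(subsetP (sub_closed_neigh D)) //.
Qed.

Hypothesis cyc_sep : beta cyc = set0.
(** The factor 3 allows for the union of three sets of size [bound] in the sweep below. *)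
Hypothesis haven :
  forall D, #|D| <= 3 * bound -> beta (closed_neigh D) != set0.

(** Otherwise the big component would avoid the cycle and so lie in [beta cyc], which is empty. *)
Lemma big_at_ex D : #|D| <= 3 * bound -> exists i, big_at D i.
Proof.
move=> /haven bD;
  have [/existsP[i iD]|/existsPn no] := boolP [exists i : 'I_r, big_at D i].
  by exists i.
case/negP: (bD); rewrite -subset0 -cyc_sep beta_sub ?beta_conn ?beta_big //.
apply/pred0P => x; apply/negP => /= /andP[xD /mem_cyc[i ir xi]].
by have /negP[] := no (Ordinal ir); rewrite /big_at ir -xi.
Qed.

(** A chord of the cycle through a component of [G - C]. The degenerate chord [f = g] is where the
    search for longer chords starts. *)
Definition linked f g := f = g \/ exists x,
  [/\ x \notin cyc, f < g, att (comp x) f & att (comp x) g].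

(** Induction on the width of the arc: no narrower arc contains a trace, so no trace can be trapped
    between the ends of a chord inside [(x, y)]. Sweeping across the arc then makes the trace
    vanish. *)
Lemma no_narrow_arc n (x y : nat) D :
    y <= x + n -> y <= r -> #|D| <= bound ->
  ~ (forall i, big_at D i -> x < i < y).
Proof.
elim: n x y D => [|n IH] x y D yxn yr Dk DV.
  have [|i /DV] := @big_at_ex D; first by clear -Dk; lia.
  by clear -yxn; lia.
(* A trace that meets [(f, g)] would, by [chord_separation], lie entirely in this narrower arc,
   against the induction hypothesis. *)
have avoid f g : x < f -> g < y -> linked f g ->
    exists2 D' : {set G}, #|D'| <= bound & forall i, big_at D' i -> ~~ (f <= i
      <= g).
  move=> xf gy [<-|[z [zcyc fg af ag]]].
    exists [set c f]; first by rewrite cards1 /bound; clear -l3; lia.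
    move=> i /big_at_notin; rewrite inE => /eqP nif; apply/negP => fi.
    by case: nif; congr c; clear -fi; lia.
  have gr : g < r by apply: leq_trans yr.
  have [D' [D'k fD gD sep]] := chord_separation zcyc fg gr af ag.
  exists D' => // i iD'; apply/negP => fig.
  have nf : i != f by apply: contraTneq iD' => ->;
    apply: contraL fD => /big_at_notin.
  have ng : i != g by apply: contraTneq iD' => ->;
    apply: contraL gD => /big_at_notin.
  have {}fig : f < i < g by clear -fig nf ng; lia.
  have dA : [disjoint beta (closed_neigh D') & D'].
    rewrite disjoint_sym (disjointWl (sub_closed_neigh D')) //.
    by rewrite disjoint_sym beta_disjoint.
  apply: (IH f g D') => //; first by clear -xf gy yxn; lia.
    exact: ltnW.
  move=> j /andP[jr jD']; case/andP: iD' => ir iD'.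
  exact: sep (beta_conn _) dA i j fig jr iD' jD'.
(* While the trace survives on both sides, [crossing] yields a longer chord to restart from. The set
   for the new chord replaces the old one, so its size stays bounded whatever the number of
   rounds. *)
have side m f g : x < f -> f <= g -> g < y -> r <= (g - f) + m -> linked f g ->
    exists2 D' : {set G}, #|D'| <= bound &
      (forall i, big_at (D :|: D') i -> i < f) \/
      (forall i, big_at (D :|: D') i -> g < i).
  elim: m f g => [|m IHm] f g xf fg gy rm fgl; first by clear -rm gy yr xf fg;
    lia.
  have [D' D'k D'V] := avoid f g xf gy fgl.
  have V i : big_at (D :|: D') i -> (x < i < f) || (g < i < y).
    move=> iV; have := DV i (big_atS (subsetUl _ _) iV).
    have := D'V i (big_atS (subsetUr _ _) iV); clear; lia.
  have [/existsP[i /andP[iV fi]]|/existsPn noL] :=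
      boolP [exists i : 'I_r, big_at (D :|: D') i && (i < f)]; last first.
    exists D' => //; right=> i iV; have ir : i < r by case/andP: iV.
    have := noL (Ordinal ir); rewrite /= iV /=; have := V i iV; clear; lia.
  have [/existsP[j /andP[jV gj]]|/existsPn noR] :=
      boolP [exists i : 'I_r, big_at (D :|: D') i && (g < i)]; last first.
    exists D' => //; left=> k kV; have kr : k < r by case/andP: kV.
    have := noR (Ordinal kr); rewrite /= kV /=; have := V k kV; clear; lia.
  pose X k := x < k < f; pose Y k := g < k < y.
  have Xi : X i by have := V i iV; rewrite /X; clear -fi fg; lia.
  have Yj : Y j by have := V j jV; rewrite /Y; clear -gj fg; lia.
  have iA : c i \in beta (closed_neigh (D :|: D')) by case/andP: iV.
  have jA : c j \in beta (closed_neigh (D :|: D')) by case/andP: jV.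
  have [||z [k [k' [zcyc [kr k'r] _ [Xk Yk'] [ak ak']]]]] :=
    @crossing _ X Y i j (beta_conn _) (ltn_ord i) (ltn_ord j) iA jA Xi Yj.
  - by move=> k kr kA; apply: V; rewrite /big_at kr.
  - move=> k k' kr k'r; rewrite /X /Y => Xk Yk'.
    split; first by clear -Xk Yk' fg; lia.
    by apply/negP => /(cyc_edge kr k'r); clear -Xk Yk' fg; lia.
  have [|||||D'' D''k side] := IHm k k'.
  - by case/andP: Xk.
  - by move: Xk Yk'; rewrite /X /Y; clear -fg; lia.
  - by case/andP: Yk'.
  - by move: Xk Yk'; rewrite /X /Y; clear -fg rm; lia.
  - by right; exists z; split=> //; move: Xk Yk'; rewrite /X /Y; clear -fg; lia.
  exists D'' => //; move: Xk Yk'; rewrite /X /Y => Xk Yk'.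
  by case: side => side; [left|right] => h /side; clear -Xk Yk'; lia.
have sweep d : x + d < y -> exists2 D' : {set G}, #|D'| <= bound &
    forall i, big_at (D :|: D') i -> x + d < i.
  elim: d => [|d IHd] xdy.
    exists set0 => [|i]; first by rewrite cards0.
    by rewrite setU0 addn0 => /DV/andP[].
  have [|D1 D1k V1] := IHd; first by clear -xdy; lia.
  have [||D2 D2k [V2|V2]] :=
    side r (x + d.+1) (x + d.+1) _ (leqnn _) xdy _ (or_introl erefl).
  - by clear; lia.
  - by clear; lia.
  (* A push to the left is impossible: [D1] keeps the trace right of [x + d] and [D2] left of
     [x + d.+1], so the union of the three sets would have an empty trace. *)
  - have [|i iV] := @big_at_ex (D :|: D1 :|: D2).
      have := (leq_card_setU (D :|: D1) D2).1; have := (leq_card_setU D D1).1.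
      by move: Dk D1k D2k; clear; lia.
    have := V1 i (big_atS (subsetUl _ _) iV).
    have := V2 i (big_atS _ iV); rewrite setUAC subsetUl => /(_ isT).
    by clear; lia.
  by exists D2.
have [|i0 /DV xy] := @big_at_ex D; first by clear -Dk; lia.
(* Swept up to [y.-1], the trace would have to lie strictly between [y.-1] and [y]. *)
have [|D' D'k V'] := sweep (y.-1 - x); first by clear -xy; lia.
have [|i iV] := @big_at_ex (D :|: D').
  by have := (leq_card_setU D D').1; move: Dk D'k; clear; lia.
have := V' i iV; have := DV i (big_atS (subsetUl _ _) iV); clear -xy; lia.
Qed.

(** The set [{c 0}] keeps the trace away from position 0, so it lies in the open arc [(0, r)]. *)
Lemma cycle_no_haven : False.
Proof.
apply: (@no_narrow_arc r 0 r [set c 0]) => //.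
  by rewrite cards1 /bound; clear -l3; lia.
move=> i iV; have [ir _] := andP iV; rewrite ir andbT lt0n.
by apply: contraTneq (big_at_notin iV) => ->; rewrite set11.
Qed.

End Cycles.

(** * Induced paths *)

Section InducedPaths.
Variable G : sgraph.
Implicit Types (A : {set G}) (s : seq G) (x y u v : G).

Fixpoint ipath s :=
  if s is x :: s' then
    [&& x \notin s', ipath s' &
      if s' is y :: s'' then (x -- y) && all (fun z => ~~ (x -- z)) s''
      else true]
  else true.

Lemma ipath_uniq s : ipath s -> uniq s.
Proof. by elim: s => //= x s IH /and3P[-> /IH ->]. Qed.

Lemma ipath_nth x0 s i j : ipath s -> i < j -> j < size s ->
  (nth x0 s i -- nth x0 s j) = (j == i.+1).
Proof.
elim: s i j => [|x s IH] [|i] [|j] //= /and3P[_ ps xs] ij js; last exact: IH.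
case: s {IH ps} xs js => //= y s /andP[xy /allP xs]; case: j ij => //= j _ js.
by apply/negbTE/xs/mem_nth.
Qed.

Lemma ipath_take n s : ipath s -> ipath (take n s).
Proof.
elim: s n => [|x s IH] [|n] //= /and3P[xs ps hx]; apply/and3P; split.
- by apply: contra xs; apply: mem_take.
- exact: IH.
- case: s {IH xs ps} hx => //= y s /andP[xy /allP hx]; case: n => //= n.
  by rewrite xy; apply/allP => z /mem_take; apply: hx.
Qed.

Lemma ipath_cat s y s' :
    ipath s -> ipath (y :: s') -> {in s, forall a, a \notin y :: s'} ->
    {in s & s', forall a b, ~~ (a -- b)} ->
    {in s, forall a, (a -- y) = (a == last y s)} ->
  ipath (s ++ y :: s').
Proof.
move=> ps ps' dis no;
  elim: s ps dis no => // x s IH /and3P[xs ps hx] dis no edge.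
have sub a : a \in s -> a \in x :: s by rewrite inE orbC => ->.
rewrite cat_cons; apply/and3P; split.
- by rewrite mem_cat negb_or xs dis ?mem_head.
- apply: IH => // [a /sub/dis //|a b /sub as_ bs|a as_]; first exact: no.
  by rewrite edge ?sub //=; case: (s) as_.
have nos' : all (fun z => ~~ (x -- z)) s'.
  by apply/allP => z zs; apply: no; rewrite ?mem_head.
have xy := edge x (mem_head _ _).
case: s xs hx xy {IH ps dis no edge sub} => [|z s] /= xs hx xy.
  by rewrite xy eqxx.
case/andP: hx => xz hx; rewrite xz all_cat hx /= nos' xy andbT /=.
by apply: contraNneq xs => ->; apply: mem_last.
Qed.

(** [v] is attached to the last vertex of the path that it equals or sees, and everything before
    that vertex is dropped. *)
Lemma ipath_cons u s v :
    ipath (u :: s) -> has (fun z => (v == z) || (v -- z)) (u :: s) ->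
  exists s', [/\ ipath (v :: s'), last v s' = last u s &
                 {subset v :: s' <= [:: v, u & s]}].
Proof.
elim: s u => [|w s IH] u pus.
  rewrite /= orbF => /orP[/eqP<-|vu]; first by exists [::]; split=> // z;
    rewrite !inE => ->.
  exists [:: u]; split=> //=; rewrite inE vu /= andbT.
  by apply: contraTneq vu => ->; rewrite sedge_irrefl.
have [hws _|nws] := boolP (has (fun z => (v == z) || (v -- z)) (w :: s)).
  have [|s' [ps' ls' ss']] := IH w _ hws; first by case/and3P: pus.
  exists s'; split=> // z /ss'; rewrite !inE => /or3P[] ->; rewrite ?orbT //.
rewrite /= -/(has _ (w :: s)) => /orP[|/(negP nws) //].
case/orP=> [/eqP ->|vu].
  by exists (w :: s); split=> // z zs; rewrite in_cons zs orbT.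
exists [:: u, w & s]; split=> //; apply/and3P; split=> //.
  rewrite inE negb_or; apply/andP; split.
    by apply: contraTneq vu => ->; rewrite sedge_irrefl.
  by apply: contra nws => vws; apply/hasP; exists v; rewrite ?eqxx.
apply/andP; split=> //; apply/allP => z zs; apply: contra nws => vz.
by apply/hasP; exists z; rewrite // vz orbT.
Qed.

(** The path is grown backwards from [y]; [ipath_cons] removes the chords at each step. *)
Lemma ipath_ex A x y : conn A -> x \in A -> y \in A ->
  exists s, [/\ ipath (x :: s), last x s = y & {subset x :: s <= A}].
Proof.
move=> /connP cA xA yA.
pose P u := exists s, [/\ ipath (u :: s), last u s = y & {subset u :: s <= A}].
apply: (connect_ind (P := P) (cA y x yA xA)).
  by exists [::]; split=> // z; rewrite inE => /eqP->.
move=> u v [s [ps ls sA]] /and3P[uA vA uv].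
have [|s' [ps' ls' ss']] := ipath_cons (v := v) ps.
  by rewrite /= sedge_sym uv orbT.
exists s'; split=> //; first by rewrite ls'.
by move=> z /ss'; rewrite inE => /predU1P[->|/sA].
Qed.

End InducedPaths.

(** * Some induced cycle is a balanced separator *)

Section Gyarfas.
Variables (l : nat) (G : sgraph).
Hypothesis l3 : 2 < l.
Hypothesis Wfree : induced_minor_free (wheel l) G.
Hypothesis haven :
  forall D : {set G}, #|D| <= l -> beta (closed_neigh D) != set0.
Implicit Types (s Q : seq G) (p x y : G) (D : {set G}).

Definition nbs s := closed_neigh [set z in s].

Lemma in_nbs s y :
  reflect (exists2 x, x \in s & x = y \/ x -- y) (y \in nbs s).
Proof.
by apply: (iffP (in_closed_neigh _ _)) => -[x xs xy]; exists x;
  rewrite ?inE // in xs *.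
Qed.

Lemma nbs_cons p Q y : (y \in nbs (p :: Q)) = (y \in nbs [:: p]) || (y \in nbs
  Q).
Proof.
apply/in_nbs/orP => [[x]|[]/in_nbs[x xs xy]].
- rewrite inE => /predU1P[->|xQ] xy; [left|right]; apply/in_nbs.
    by exists p; rewrite ?mem_head.
  by exists x.
- by exists x => //; move: xs; rewrite !inE => ->.
- by exists x => //; rewrite inE xs orbT.
Qed.

(** The newest vertex [p] stands at the head. As it dominates some vertex of [beta (nbs Q)], adding
    it shrinks the big component, which bounds the number of steps. *)
Lemma gyarfas_step n p Q :
    #|beta (nbs Q)| <= n -> ipath (p :: Q) ->
    (exists2 x, x \in beta (nbs Q) & x \in nbs [:: p]) ->
  exists p' Q', [/\ ipath (p' :: Q'), beta (nbs Q') != set0 &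
                    beta (nbs (p' :: Q')) = set0].
Proof.
elim: n p Q => [|n IH] p Q Bn pQ [x xB xp].
  by move: Bn; rewrite leqn0 cards_eq0 => /eqP B0; rewrite B0 inE in xB.
have B0 : beta (nbs Q) != set0 by apply/set0Pn; exists x.
have [B'0|/set0Pn[z zB']] := eqVneq (beta (nbs (p :: Q))) set0.
  by exists p, Q.
have sB : beta (nbs (p :: Q)) \subset beta (nbs Q).
  by apply/beta_subS/subsetP => y; rewrite nbs_cons orbC => ->.
have xB' : x \notin beta (nbs (p :: Q)).
  by apply/negP => /beta_notin; rewrite nbs_cons xp.
(* [w] is the next path vertex: it is a neighbour of [p], and it sees nothing on [Q] because it lies
   in [beta (nbs Q)]. The vertex [u] preserves the invariant. *)
have [u [w [uB uB' wB wB' uw]]] :=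
  conn_edge (beta_conn _) (subsetP sB z zB') zB' xB xB'.
have wnQ := beta_notin wB.
have wp : w \in nbs [:: p].
  apply: contraR wB' => wnp; apply: beta_closed uB' uw _.
  by rewrite nbs_cons negb_or wnp.
have := beta_notin uB'; rewrite nbs_cons negb_or => /andP[unp unQ].
have pw : p -- w.
  have /in_nbs[p']:= wp; rewrite inE => /eqP-> [pw|//].
  by case/negP: unp; apply/in_nbs; exists p; rewrite ?mem_head // pw sedge_sym;
    right.
have farQ y : y \in Q -> w <> y /\ ~~ (w -- y).
  move=> yQ; split=> [wy|].
    by case/negP: wnQ; apply/in_nbs; exists y => //; left.
  by apply: contra wnQ => wy; apply/in_nbs; exists y; rewrite // sedge_sym;
    right.
apply: (IH w (p :: Q)).
- by rewrite -ltnS (leq_trans _ Bn) // proper_card // properE sB;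
    apply/subsetPn; exists x.
- apply/and3P; split=> //.
    rewrite inE negb_or; apply/andP; split.
      by apply: contraTneq pw => ->; rewrite sedge_irrefl.
    by apply/negP => /farQ[].
  by rewrite sedge_sym pw; apply/allP => y /farQ[].
- by exists u => //; apply/in_nbs; exists w; rewrite ?mem_head // sedge_sym;
    right.
Qed.

Lemma nbs1 p : nbs [:: p] = closed_neigh [set p].
Proof.
rewrite /nbs (_ : [set _ in _] = [set p]) //.
by apply/setP => z; rewrite !inE.
Qed.

Lemma gyarfas_path : exists p q Q, [/\ ipath [:: p, q & Q],
  beta (nbs (q :: Q)) != set0 & beta (nbs [:: p, q & Q]) = set0].
Proof.
have /set0Pn[p pB] : beta (nbs [::]) != set0.
  by apply: haven; rewrite (_ : [set _ in _] = set0) ?cards0 //;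
    apply/setP => z; rewrite !inE.
have [|p' [[|q Q] [pQ B B0]]] := gyarfas_step (leqnn _) (isT : ipath [:: p]).
- by exists p => //; apply/in_nbs; exists p; rewrite ?mem_head //; left.
(* The path has at least two vertices, since the closed neighbourhood of a single vertex is not
   balanced. *)
- by have := haven (D := [set p']);
    rewrite -nbs1 B0 eqxx cards1 => /(_ (ltnW (ltnW l3))).
- by exists p', q, Q.
Qed.

(** If [beta (closed_neigh D)] stayed inside [beta (nbs Q)], it would also avoid the neighbourhood
    of [p], which is in [D], and so lie in the empty set [beta (nbs (p :: Q))]. *)
Lemma unbalanced_exit p Q D :
    beta (nbs Q) != set0 -> beta (nbs (p :: Q)) = set0 ->
    #|D| <= l -> p \in D ->
  exists u v, [/\ u \in beta (nbs Q), v \notin beta (nbs Q),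
    v \in beta (closed_neigh D) & u -- v].
Proof.
move=> B0 B'0 Dl pD; have D0 := haven Dl.
have [x [xB xD]] := beta_meet B0 D0.
have [sDB|/subsetPn[y yD yB]] :=
  boolP (beta (closed_neigh D) \subset beta (nbs Q)).
  case/negP: D0; rewrite -subset0 -B'0 beta_sub ?beta_conn ?beta_big ?haven //.
  apply/pred0P => y; apply/negP => /= /andP[yD].
  rewrite nbs_cons (negbTE (beta_notin (subsetP sDB y yD))) orbF nbs1.
  have /closed_neighS sD : [set p] \subset D by rewrite sub1set.
  by move/(subsetP sD); apply/negP/beta_notin.
have [u [v [_ uB vD vB uv]]] := conn_edge (beta_conn _) xD xB yD yB.
by exists u, v.
Qed.

Lemma separating_cycle : exists r c,
  icycle r c /\ beta (@cyc G r c) = set0.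
Proof.
have [p [q [Q0 [pQ B0 B'0]]]] := gyarfas_path.
set Q := q :: Q0 in pQ B0 B'0; pose B := beta (nbs Q).
have pB : p \notin B.
  apply/negP => /beta_notin/negP; apply; apply/in_nbs; exists q;
    rewrite ?mem_head //.
  by right; rewrite sedge_sym; have /and3P[_ _ /andP[]] := pQ.
have BnQ b y : b \in B -> y \in Q -> ~~ (y -- b) /\ b != y.
  move=> /beta_notin bQ yQ; split; apply: contra bQ => yb; apply/in_nbs.
    by exists y => //; right.
  by exists y => //; left; rewrite (eqP yb).
have [w wB pw] : exists2 w, w \in B & p -- w.
  have [/exists_inP//|/exists_inPn no] := boolP [exists w in B, p -- w].
  case/negP: (B0); rewrite -subset0 -B'0 beta_sub ?beta_conn ?beta_big //.
  apply/pred0P => y; apply/negP => /= /andP[yB].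
  rewrite nbs_cons (negbTE (beta_notin yB)) orbF => /in_nbs[p'].
  rewrite inE => /eqP-> [py|/(negP (no y yB)) //].
  by rewrite py yB in pB.
pose T := [set t | [&& t \notin B, t \notin nbs [:: p] & [exists b in B, b --
  t]]].
have exitT D : #|D| <= l -> p \in D ->
    exists2 t, t \in T & t \in beta (closed_neigh D).
  move=> Dl pD; have [b [t [bB tB tD bt]]] := unbalanced_exit B0 B'0 Dl pD.
  exists t => //; rewrite inE tB /=; apply/andP; split; last first.
    by apply/exists_inP; exists b.
  apply: contra (beta_notin tD); rewrite nbs1.
  by apply/subsetP/closed_neighS; rewrite sub1set.
(* [Q] starts at the neighbour of [p], so [z t] locates the neighbour of [t] on [Q] that is closest
   to [p]. *)
pose z t := find (fun y => y -- t) Q.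
have zQ t : t \in T -> z t < size Q /\ nth p Q (z t) -- t.
  rewrite inE => /and3P[tB _ /exists_inP[b bB bt]].
  have hasQ : has (fun y => y -- t) Q.
    have : t \in nbs Q by apply: contraR tB; apply: beta_closed bB bt.
    case/in_nbs=> y yQ [yt|yt]; apply/hasP; exists y => //.
    by have [/negP[]] := BnQ b y bB yQ; rewrite yt sedge_sym.
  by rewrite /z -has_find; split=> //; apply: (nth_find p hasQ).
have [|t0 t0T _] := exitT [set p] _ (set11 p);
  first by rewrite cards1 ltnW // ltnW.
have [t tT tmax] : exists2 t, t \in T & forall t', t' \in T -> z t' <= z t.
  by case: (arg_maxnP z t0T) => t tT tmax; exists t.
have [zt qt] := zQ t tT; have := tT.
rewrite inE => /and3P[tB tp /exists_inP[b bB bt]].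
have ntp : t != p.
  by apply: contra tp => /eqP ->; apply/in_nbs; exists p; rewrite ?mem_head //;
    left.
have npt : ~~ (p -- t).
  by apply: contra tp => pt; apply/in_nbs; exists p; rewrite ?mem_head //;
    right.
have cA : conn (B :|: [set p] :|: [set t]).
  apply: connU_adj; rewrite ?conn1 //; last first.
    by apply/adjP; exists b, t; rewrite !inE bB eqxx.
  apply: connU_adj; rewrite ?conn1 ?beta_conn //.
  by apply/adjP; exists w, p; rewrite !inE wB eqxx sedge_sym.
(* An induced path from [t] back to [p]. Its inner vertices [s1] lie in [B], and there is at least
   one because [p] and [t] are not adjacent. *)
have [||s [ps ls sA]] := @ipath_ex _ _ t p cA; rewrite ?inE ?eqxx ?orbT //.
case: (lastP s) ps ls sA => [_ /eqP|s1 p' ps]; first by rewrite (negbTE ntp).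
rewrite last_rcons => pE sA; rewrite {p'}pE in ps sA.
have := ipath_uniq ps; rewrite -rcons_cons rcons_uniq => /andP[ps1 ts1].
have s1B y : y \in s1 -> y \in B.
  move=> ys; have := sA y; rewrite !inE mem_rcons !inE ys !orbT => /(_ isT).
  have [yp|_] := eqVneq y p; first by rewrite -yp inE ys orbT in ps1.
  have [yt|_] := eqVneq y t; last by rewrite !orbF.
  by move: ts1; rewrite -yt /= ys.
have ps' : ipath (t :: s1).
  have := ipath_take (size s1).+1 ps.
  by rewrite -rcons_cons -cats1 -[(size s1).+1]/(size (t :: s1)) take_size_cat.
have s1N : 0 < size s1.
  case: s1 ps {ps1 ts1 s1B ps' sA} => //= /andP[_ /andP[tp' _]].
  by rewrite sedge_sym tp' in npt.
have [pnQ pQ'] : p \notin Q /\ ipath Q by case/and3P: pQ.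
(* [L] runs along [Q] to the first neighbour of [t], then through [t] and [B]. As [p] sees only its
   two ends, [p :: L] is an induced cycle. *)
pose Q1 := take (z t).+1 Q; pose L := Q1 ++ t :: s1.
have szQ1 : size Q1 = (z t).+1 by rewrite size_takel.
have Q1Q y : y \in Q1 -> y \in Q by apply: mem_take.
have tnQ y : y \in Q -> y != t.
  move=> yQ; apply: contraTneq bt => <-; rewrite sedge_sym.
  by have [] := BnQ b y bB yQ.
have pL : ipath L.
  apply: ipath_cat => //; first exact: ipath_take.
  - move=> y /Q1Q yQ; rewrite inE negb_or tnQ //=.
    by apply/negP => /s1B yB; have [_] := BnQ y y yB yQ; rewrite eqxx.
  - by move=> y b' /Q1Q yQ /s1B b'B; have [] := BnQ b' y b'B yQ.
  move=> y /(nthP p)[i]; rewrite szQ1 => iz <-.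
  rewrite -nth_last szQ1 /= (set_nth_default p) ?szQ1 // !nth_take //.
  have iQ : i < size Q by apply: leq_ltn_trans zt.
  rewrite nth_uniq ?(ipath_uniq pQ') //.
  have [->|iNz] := eqVneq i (z t); first by rewrite qt.
  have {}iz : i < z t by rewrite ltn_neqAle iNz.
  exact: (@before_find _ p (fun y => y -- t) Q i iz).
have pnL : p \notin L.
  by rewrite mem_cat negb_or ps1 andbT; apply: contra pnQ; apply: Q1Q.
have szL : size L = (z t).+2 + size s1 by rewrite size_cat szQ1 /= addnS.
have pLnth j : j < size L ->
    (p -- nth p L j) = (j == 0) || (j == (size L).-1).
  move=> jL; rewrite nth_cat szQ1; case: ltnP => jz.
    rewrite nth_take // -[nth p Q j]/(nth p (p :: Q) j.+1).
    rewrite -{1}[p]/(nth p (p :: Q) 0) (ipath_nth _ pQ) //; last first.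
      by rewrite /= ltnS (leq_trans jz).
    by rewrite eqSS szL; clear -jz s1N; lia.
  pose m := j - (z t).+1.
  have mE : m < (size s1).+1 by rewrite /m; clear -jL szL jz; lia.
  have -> : nth p (t :: s1) m = nth p (t :: rcons s1 p) m.
    by rewrite -rcons_cons nth_rcons /= mE.
  have -> : (p -- nth p (t :: rcons s1 p) m) = ((size s1).+1 == m.+1).
    have := @ipath_nth _ p _ m (size s1).+1 ps mE.
    by rewrite /= size_rcons nth_rcons ltnn eqxx sedge_sym; apply.
  by rewrite /m szL; clear -jz s1N; lia.
pose c := nth p (p :: L).
have cC : icycle (size L).+1 c.
  move=> i [//|j] ij jr; rewrite /c [nth p (p :: L) j.+1]/=.
  case: i ij => [_|i ij]; rewrite /=.
    split; last by rewrite pLnth // eqSS.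
    by apply: contraNneq pnL => ->; apply: mem_nth.
  rewrite (ipath_nth _ pL) // orbF eqSS; split=> //.
  have {}ij : i < j := ij; have {}jr : j < size L := jr.
  have iL := ltn_trans ij jr.
  by rewrite nth_uniq ?(ipath_uniq pL) // neq_ltn ij.
exists (size L).+1, c; split=> //.
apply/eqP; apply: contraT => K0; pose K := beta (cyc (size L).+1 c).
(* There are fewer than [l] contacts of [K], so [p |: F] has at most [l] elements and the haven
   hypothesis applies to it. *)
pose F := [set c (nat_of_ord i) | i in [set i : 'I_(size L).+1 | att c K i]].
have Fl : #|F| < l.
  apply: leq_ltn_trans (leq_imset_card _ _) _; apply: few_att => //.
    exact: beta_conn.
  exact: beta_disjoint.
have inF i : i < (size L).+1 -> att c K i -> c i \in p |: F.
  move=> ir ai; apply/setU1P; right; apply/imsetP.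
  by exists (Ordinal ir); rewrite ?inE.
have Dl : #|p |: F| <= l.
  by apply: leq_trans (leq_card_setU _ _) _; rewrite cards1.
have [t' t'T t'D] := exitT _ Dl (setU11 _ _).
(* The two big components meet, and leaving [K] means stepping onto a contact, which lies in [F]. *)
have DK : beta (closed_neigh (p |: F)) \subset K.
  apply/subsetP => y yD; apply: contraT => yK.
  have [x [xK xD]] := beta_meet K0 (haven Dl).
  have [u [v [_ uK vD vK uv]]] := conn_edge (beta_conn _) xD xK yD yK.
  have /mem_cyc[i ir vE] : v \in cyc (size L).+1 c.
    by apply: contraR vK; apply: beta_closed uK uv.
  have := beta_notin vD; rewrite vE => /negP[].
  apply: (subsetP (sub_closed_neigh _)); apply: inF => //.
  by apply/attP; exists u; rewrite // -vE.
have [_ qt'] := zQ t' t'T; have zt' := tmax t' t'T.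
(* By the maximality of [z t], the first neighbour of [t'] on [Q] belongs to [Q1]; its index shifts
   by one because [p] is at position 0 of the cycle. *)
have cE : c (z t').+1 = nth p Q (z t').
  by rewrite /c /= nth_cat szQ1 ltnS zt' nth_take.
case/negP: (beta_notin t'D); apply/in_closed_neigh.
exists (c (z t').+1); last by right; rewrite cE.
apply: inF; first by rewrite szL; clear -zt'; lia.
by apply/attP; exists t'; [apply: (subsetP DK)|rewrite cE sedge_sym].
Qed.

End Gyarfas.

(** * Dominated balanced separators in wheel-free graphs *)

Theorem theorem1p2 (l : nat) (hl : 3 <= l) :
  exists k : nat, forall G : sgraph, induced_minor_free (wheel l) G ->
    exists S : {set G}, balanced_separator S /\
      exists D : {set G}, #|D| <= k /\ S \subset closed_neigh D.
Proof.
(* The value that [cycle_no_haven] requires; it is at least [l], as [separating_cycle] asks. The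
   separator will be a whole closed neighbourhood. *)
exists (3 * bound l) => G Wfree.
have [/existsP[D /andP[Dk /eqP D0]]|/existsPn no] :=
    boolP [exists D : {set G},
      (#|D| <= 3 * bound l) && (beta (closed_neigh D) == set0)].
  exists (closed_neigh D); split; first exact: beta0_balanced.
  by exists D.
have haven (D : {set G}) : #|D| <= 3 * bound l -> beta (closed_neigh D) != set0.
  by move=> Dk; have := no D; rewrite Dk.
have [D Dl|r [c [cC sep]]] := @separating_cycle l G hl Wfree.
  by apply: haven; rewrite /bound; clear -Dl; lia.
by case: (@cycle_no_haven l G hl Wfree r c cC sep).
Qed.
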